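(* Let $G$ be a finite group such that $(G,Z(G))$ is a Camina pair. Then $G$ is a $p$-group for some prime $p$.
   Context: A pair $(G,N)$ is a Camina pair if $N$ is a normal subgroup of the finite group $G$ with $1 < N < G$ (i.e. $N$ is nontrivial and proper) and every element $g \in G \setminus N$ is conjugate in $G$ to every element of the coset $gN$. Here $Z(G)$ is the center of $G$. *)

(* Defs.v *)
From mathcomp Require Import all_boot all_fingroup.

Set Implicit Arguments.
Unset Strict Implicit.
Unset Printing Implicit Defensive.

Local Open Scope group_scope.

Definition camina_pair (gT : finGroupType) (G N : {group gT}) : Prop :=
  [/\ N <| G, N :!=: 1, N \proper G &
      forall g h, g \in G :\: N -> h \in g *: N ->
        exists2 x, x \in G & h = g ^ x].

(* Main.v *)
(* If a prime p divides |Z(G)|, take z central of order p: a noncentral p'-element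
   g would be conjugate to g z, whose order is p #[g]; so all p'-elements of G are
   central. If a second prime q divided |G|, it would divide |Z(G)| too, so both
   the p-part and the p'-part of every element would be central, and G = Z(G). *)
Require Import Defs.
From mathcomp Require Import all_boot all_fingroup all_solvable.

Local Open Scope group_scope.

Lemma camina_center_p'elt (gT : finGroupType) (G : {group gT}) (p : nat) (g : gT) :
    camina_pair G 'Z(G)%G -> prime p -> p %| #|'Z(G)| ->
  g \in G -> p^'.-elt g -> g \in 'Z(G).
Proof.
move=> [_ _ _ conjG] p_pr pZ gG p'g; apply/negPn/negP => gNZ.
have [z zZ oz] := Cauchy p_pr pZ.
have [||x _ gzE] := conjG g (g * z); first by rewrite inE gNZ.
  by rewrite mem_lcoset mulKg.
have cgz : commute g z by case/centerP: zZ => _ cGz; apply/esym/cGz.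
have : #[g * z] = #[g] by rewrite gzE orderJ.
(* The commuting elements [g] and [z] have coprime orders, so [#[g * z]] is [#[g] * p]; equality
   with [#[g]] forces [p = 1]. *)
rewrite orderM // oz; last first.
  by rewrite coprime_sym prime_coprime // -p'natE.
move/eqP; rewrite -{2}[#[g]]muln1 eqn_pmul2l ?order_gt0 // => /eqP p1.
by rewrite p1 in p_pr.
Qed.

Theorem lemma2p1 (gT : finGroupType) (G : {group gT}) :
  camina_pair G 'Z(G)%G -> exists p : nat, prime p /\ p.-group G.
Proof.
move=> camG; have [_ ntZ ltZG _] := camG.
pose p := pdiv #|'Z(G)|.
have p_pr : prime p by rewrite pdiv_prime // cardG_gt1.
have p'Z := camina_center_p'elt _ _ _ _ camG p_pr (pdiv_dvd _).
exists p; split=> //; apply/pgroupP => q q_pr qG; apply/negPn/negP => neq_qp.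
have [x xG ox] := Cauchy q_pr qG.
(* Having prime order [q != p], [x] is a [p^']-element, hence central; this makes [q] divide the
   order of the center. *)
have xZ : x \in 'Z(G) by apply: p'Z => //; rewrite /p_elt ox pnatE.
have qZ : q %| #|'Z(G)| by rewrite -ox order_dvdG.
have q'Z := camina_center_p'elt _ _ _ _ camG q_pr qZ.
have /subsetPn[g gG /negP[]] := proper_subn ltZG.
(* The [p^']-part of [g] falls under [p'Z]; its [p]-part is a [q^']-element and falls under
   [q'Z]. *)
rewrite -(consttC p g) groupM //; last by apply: p'Z; rewrite ?groupX ?p_elt_constt.
apply: q'Z; first by rewrite groupX.
apply: sub_p_elt (p_elt_constt p g) => r /eqP ->.
by apply: contra neq_qp => /eqP ->; rewrite inE.
Qed.
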